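(* Let $p\ge 5$ be a prime, let $C,D\in\mathbb{F}_p$, let $$f(x,y,z)=x^2+y^2+z^2-xyz+C(x+y+z)-D,$$ and put $D_\bullet=4-2C-\frac{C^2}{4}\in\mathbb{F}_p$. Let $N_2(f)$ be the number of $(x,y,z)\in\mathbb{F}_p^3$ with $f(x,y,z)=0$, $(\partial_y f)(x,y,z)=0$ and $(\partial_z f)(x,y,z)=0$. Then the following hold. (i) If $D=D_\bullet$, then $N_2(f)=\big(1+\llbracket C=0\rrbracket\big)p+1-\llbracket C=0\rrbracket-\llbracket C=8\rrbracket$. (ii) If $D\neq D_\bullet$, then $N_2(f)=N_0(\kappa)-\llbracket C=0\rrbracket$, where $N_0(\kappa)$ is the number of distinct roots in $\mathbb{F}_p$ of the cubic $$\kappa(x)=x^3+(C-2)x^2-(2C+D)x+C^2+2D.$$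
   Context: The Iverson bracket $\llbracket \mathcal{S}\rrbracket$ is $1$ if the statement $\mathcal{S}$ is true and $0$ otherwise; equalities such as $C=8$ are in $\mathbb{F}_p$. *)

(* Defs.v *)
From HB Require Import structures.
From mathcomp Require Import all_boot all_order all_algebra.
From mathcomp Require Import mpoly.

Set Implicit Arguments.
Unset Strict Implicit.
Unset Printing Implicit Defensive.

Import GRing.Theory.
Local Open Scope ring_scope.

(* The numerals below are elements of 'I_3 viewed as the ring Z/3Z, so that
   2 is the ordinal with value 2 *)
Definition ix : 'I_3 := 0.
Definition iy : 'I_3 := 1.
Definition iz : 'I_3 := 2.

Definition fCD (R : comNzRingType) (C D : R) : {mpoly R[3]} :=
  let x : {mpoly R[3]} := 'X_ix in
  let y : {mpoly R[3]} := 'X_iy in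
  let z : {mpoly R[3]} := 'X_iz in
  x ^+ 2 + y ^+ 2 + z ^+ 2 - x * y * z + C%:MP * (x + y + z) - D%:MP.

Definition Dbullet (F : fieldType) (C : F) : F := 4 - 2 * C - C ^+ 2 / 4.

Definition kappa (R : comNzRingType) (C D : R) : {poly R} :=
  'X^3 + (C - 2)%:P * 'X^2 - (2 * C + D)%:P * 'X + (C ^+ 2 + 2 * D)%:P.

Definition N2 (F : finFieldType) (f : {mpoly F[3]}) : nat :=
  #|[set v : {ffun 'I_3 -> F} |
      [&& f.@[v] == 0, f^`M(iy).@[v] == 0 & f^`M(iz).@[v] == 0]]|.

Definition N0 (F : finFieldType) (q : {poly F}) : nat :=
  #|[set x : F | root q x]|.

(* Main.v *)
(* Since f_y - f_z = (y - z)(2 + x), a solution has x = -2 or y = z.  On x = -2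
   the system says that y + z = -C/2 and D = D_bullet: a line or nothing.  If
   y = z, then (2 - x) y = -C; so x = 2 forces C = 0 and D = D_bullet, giving the
   line y = z, while for x <> 2 one has y = C / (x - 2), and the remaining equation
   is kappa(x) = 0.  Finally kappa(-2) = 4 (D - D_bullet) and kappa(2) = C^2, and
   kappa(x) = (x + 2) (x - (4 - C)/2)^2 when D = D_bullet. *)
Require Import Defs.
From mathcomp Require Import all_boot all_order all_algebra.
From mathcomp Require Import mpoly zify ring.

Import GRing.Theory.
Local Open Scope ring_scope.

(** * Values of f and of its partial derivatives *)

Lemma meval_fCD (R : comNzRingType) (C D : R) (v : 'I_3 -> R) :
  (fCD C D).@[v] = v ix ^+ 2 + v iy ^+ 2 + v iz ^+ 2 - v ix * v iy * v iz
                     + C * (v ix + v iy + v iz) - D.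
Proof.
by rewrite /fCD !expr2 !(mevalD, mevalN, mevalM, mevalC, mevalXU).
Qed.

Lemma mderivXU (R : nzRingType) (n : nat) (i j : 'I_n) :
  ('X_i : {mpoly R[n]})^`M(j) = (i == j)%:R.
Proof.
rewrite mderivX mnm1E; case: eqP => [->|_]; last by rewrite scale0r.
suff -> : (U_(j) - U_(j) = 0 :> 'X_{1..n})%MM by rewrite mpolyX0 scale1r.
by apply/mnmP => k; rewrite mnmBE mnm0E subnn.
Qed.

Lemma meval_fCD_y (R : comNzRingType) (C D : R) (v : 'I_3 -> R) :
  (fCD C D)^`M(iy).@[v] = 2 * v iy - v ix * v iz + C.
Proof.
rewrite /fCD !expr2 !(mderivD, mderivN, mderivM, mderivC, mderivXU) /=.
rewrite !(mevalD, mevalN, mevalM, mevalC, mevalXU, meval0, meval1).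
ring.
Qed.

Lemma meval_fCD_z (R : comNzRingType) (C D : R) (v : 'I_3 -> R) :
  (fCD C D)^`M(iz).@[v] = 2 * v iz - v ix * v iy + C.
Proof.
rewrite /fCD !expr2 !(mderivD, mderivN, mderivM, mderivC, mderivXU) /=.
rewrite !(mevalD, mevalN, mevalM, mevalC, mevalXU, meval0, meval1).
ring.
Qed.

Lemma horner_kappa (R : comNzRingType) (C D x : R) :
  (kappa C D).[x]
    = x ^+ 3 + (C - 2) * x ^+ 2 - (2 * C + D) * x + (C ^+ 2 + 2 * D).
Proof. by rewrite /kappa !hornerE. Qed.

(** The default value [x] of [nth] is never reached, an index being below 3. *)
Definition point {R : Type} (x y z : R) : {ffun 'I_3 -> R} :=
  [ffun i : 'I_3 => nth x [:: x; y; z] i].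

Lemma point_ix (R : Type) (x y z : R) : point x y z ix = x.
Proof. by rewrite ffunE. Qed.

Lemma point_iy (R : Type) (x y z : R) : point x y z iy = y.
Proof. by rewrite ffunE. Qed.

Lemma point_iz (R : Type) (x y z : R) : point x y z iz = z.
Proof. by rewrite ffunE. Qed.

Definition pointE := (point_ix, point_iy, point_iz).

Lemma point_eta {R : Type} (v : {ffun 'I_3 -> R}) :
  v = point (v ix) (v iy) (v iz).
Proof.
(* The ring numerals behind [ix], [iy], [iz] match the concrete ordinals only through their
   values. *)
apply/ffunP => -[[|[|[|//]]] lt_i3]; rewrite ffunE /=;
  by congr (v _); apply: val_inj.
Qed.

(** * Solutions with a given first coordinate *)

Section Count.

Variables (F : finFieldType) (C D : F).
Hypothesis two_neq0 : 2 != 0 :> F.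

Let four_neq0 : 4 != 0 :> F.
Proof. by rewrite (_ : 4 = 2 * 2) ?mulf_neq0 // -natrM. Qed.

Lemma kappa_opp2 : (kappa C D).[-2] = 4 * (D - Dbullet C).
Proof. by rewrite horner_kappa /Dbullet; field. Qed.

Lemma kappa_2 : (kappa C D).[2] = C ^+ 2.
Proof. by rewrite horner_kappa; ring. Qed.

Definition sol (x y z : F) :=
  [&& x ^+ 2 + y ^+ 2 + z ^+ 2 - x * y * z + C * (x + y + z) - D == 0,
      2 * y - x * z + C == 0 & 2 * z - x * y + C == 0].

(* [2 f - y f_y - z f_z = 2 (x^2 + C x - D) + C (y + z)] and
   [f_y - f_z = (y - z) (2 + x)]. *)
Lemma sol_reduce x y z : sol x y z =
  [&& 2 * (x ^+ 2 + C * x - D) + C * (y + z) == 0,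
      (y - z) * (2 + x) == 0 & 2 * z - x * y + C == 0].
Proof.
rewrite /sol; set f := (X in X == 0); set g := 2 * y - _ + _.
set h := 2 * z - _ + _.
have -> : 2 * (x ^+ 2 + C * x - D) + C * (y + z) = 2 * f - y * g - z * h.
  by rewrite /f /g /h; ring.
have -> : (y - z) * (2 + x) = g - h by rewrite /g /h; ring.
(* Both sides contain h = 0; given this, the second equations agree, and once g = 0 the first ones
   differ by the invertible factor 2. *)
case: (eqVneq h 0) => [->|_]; last by rewrite !andbF.
case: (eqVneq g 0) => [->|g_neq0]; last by rewrite subr0 (negbTE g_neq0) !andbF.
by rewrite !mulr0 !subr0 eqxx mulf_eq0 (negbTE two_neq0).
Qed.

(** These parametrise the three families of solutions. The two lines are injective through the
    coordinate y, [root_point] through x. *)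
Definition line_opp (t : F) := point (-2) t (- (C / 2) - t).
Definition line_diag (t : F) := point 2 t t.
Definition root_point (x : F) := point x (C / (x - 2)) (C / (x - 2)).

(** The second reduced equation is void at x = -2, the third is linear in z, and inserting its
    solution turns the first into -2 (D - [Dbullet C]) = 0. *)
Lemma sol_opp y z :
  sol (-2) y z = (D == Dbullet C) && (z == - (C / 2) - y).
Proof.
rewrite sol_reduce subrr mulr0 eqxx /=.
have -> : 2 * z - -2 * y + C = 2 * (z - (- (C / 2) - y)) by field.
rewrite mulf_eq0 (negbTE two_neq0) /= subr_eq0.
case: (z =P _) => [->|_]; last by rewrite !andbF.
rewrite !andbT -(subr_eq0 D).
have -> : 2 * ((-2) ^+ 2 + C * -2 - D) + C * (y + (- (C / 2) - y))
            = - 2 * (D - Dbullet C).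
  by rewrite /Dbullet; field; rewrite ?two_neq0 ?four_neq0.
by rewrite mulf_eq0 oppr_eq0 (negbTE two_neq0).
Qed.

(** Here 2 + x = 4 is invertible, so y = z; the third reduced equation becomes C = 0, and the first
    is then -2 (D - [Dbullet 0]) = 0. *)
Lemma sol_diag y z :
  sol 2 y z = [&& C == 0, D == Dbullet C & z == y].
Proof.
rewrite sol_reduce -natrD mulf_eq0 (negbTE four_neq0) orbF subr_eq0.
rewrite [z == y]eq_sym; case: (y =P z) => [->|_]; last by rewrite !andbF.
have -> : 2 * z - 2 * z + C = C by ring.
have [->|_] := eqVneq C 0; last by rewrite !andbF.
rewrite -(subr_eq0 D).
have -> : 2 * (2 ^+ 2 + 0 * 2 - D) + 0 * (z + z) = - 2 * (D - Dbullet 0).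
  by rewrite /Dbullet; field; rewrite ?two_neq0 ?four_neq0.
by rewrite mulf_eq0 oppr_eq0 (negbTE two_neq0) !andbT.
Qed.

(** As 2 + x is invertible, y = z. The third reduced equation then fixes z because x - 2 is
    invertible, and the first becomes 2 / (x - 2) times the value of [kappa C D] at x. *)
Lemma sol_generic x y z : x != -2 -> x != 2 ->
  sol x y z = [&& root (kappa C D) x, y == C / (x - 2) & z == C / (x - 2)].
Proof.
rewrite -(subr_eq0 x (-2)) opprK addrC -(subr_eq0 x 2) => x_opp x_diag.
rewrite sol_reduce mulf_eq0 (negbTE x_opp) orbF subr_eq0.
have [->|y_neq] := eqVneq y z; last first.
  rewrite andbF; apply/esym/negbTE; apply: contraNN y_neq.
  by case/and3P => _ /eqP -> /eqP ->.
rewrite andbb /=.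
have -> : 2 * z - x * z + C = - (x - 2) * (z - C / (x - 2)) by field.
rewrite mulf_eq0 oppr_eq0 (negbTE x_diag) /= subr_eq0.
case: (z =P _) => [->|_]; last by rewrite !andbF.
rewrite !andbT /root.
have -> : 2 * (x ^+ 2 + C * x - D) + C * (C / (x - 2) + C / (x - 2))
            = 2 / (x - 2) * (kappa C D).[x].
  by rewrite horner_kappa; field.
by rewrite !mulf_eq0 invr_eq0 (negbTE x_diag) (negbTE two_neq0).
Qed.

(** * Counting the solutions *)

Lemma N2_sol :
  N2 (fCD C D) = #|[set v : {ffun 'I_3 -> F} | sol (v ix) (v iy) (v iz)]|.
Proof.
by apply: eq_card => v; rewrite !inE meval_fCD meval_fCD_y meval_fCD_z.
Qed.

Lemma two_neqN2 : (2 == -2 :> F) = false.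
Proof. by rewrite -subr_eq0 opprK -natrD (negbTE four_neq0). Qed.

(** The solutions are split into the slices x = -2, x = 2 and the rest. Each of the first two is
    empty or a line; in the rest, x is a root that determines the point. *)
Lemma N2_count : N2 (fCD C D) =
  ((D == Dbullet C) * #|F| + ((C == 0%R) && (D == Dbullet C)) * #|F|
   + #|[set x | [&& root (kappa C D) x, x != -2%R & x != 2%R]]|)%N.
Proof.
rewrite N2_sol -(cardsID [set v : {ffun 'I_3 -> F} | v ix == -2]).
rewrite -(cardsID [set v : {ffun 'I_3 -> F} | v ix == 2] (_ :\: _)) addnA.
congr (_ + _ + _)%N.
- have [D_eq|D_neq] := boolP (D == Dbullet C); last first.
    apply/eqP; rewrite cards_eq0; apply/eqP/setP => v; rewrite !inE.
    by case: eqP => [->|]; rewrite ?andbF // sol_opp (negbTE D_neq).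
  rewrite mul1n -(@card_imset _ _ line_opp); last first.
    by move=> s t /ffunP/(_ iy); rewrite !pointE.
  apply: eq_card => v; rewrite !inE; apply/andP/imsetP => [[v_sol /eqP vx]|].
    exists (v iy) => //; rewrite [LHS]point_eta vx.
    by move: v_sol; rewrite vx sol_opp => /andP[_ /eqP ->].
  by case=> t _ ->; rewrite !pointE sol_opp D_eq !eqxx.
- have [/andP[C_eq D_eq]|CD_neq] := boolP (_ && _); last first.
    apply/eqP; rewrite cards_eq0; apply/eqP/setP => v; rewrite !inE.
    case: (v ix =P 2) => [->|]; rewrite ?andbF // sol_diag [(C == 0) && _]andbA.
    by rewrite (negbTE CD_neq) andbF.
  rewrite mul1n -(@card_imset _ _ line_diag); last first.
    by move=> s t /ffunP/(_ iy); rewrite !pointE.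
  apply: eq_card => v; rewrite !inE; apply/andP/imsetP.
    case=> /andP[_ v_sol] /eqP vx.
    exists (v iy) => //; rewrite [LHS]point_eta vx.
    by move: v_sol; rewrite vx sol_diag => /and3P[_ _ /eqP ->].
  (* The slice x = 2 was taken outside the slice x = -2, hence the need for 2 and -2 to differ. *)
  by case=> t _ ->; rewrite !pointE sol_diag C_eq D_eq !eqxx two_neqN2.
rewrite -(@card_imset _ _ root_point); last first.
  by move=> s t /ffunP/(_ ix); rewrite !pointE.
apply: eq_card => v; rewrite !inE; apply/and3P/imsetP.
  case=> x_diag x_opp; rewrite sol_generic // => /and3P[x_root /eqP vy /eqP vz].
  exists (v ix); first by rewrite inE x_root x_opp.
  by rewrite [LHS]point_eta vy vz.
case=> x; rewrite inE => /and3P[x_root x_opp x_diag] ->.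
by rewrite !pointE sol_generic // x_root !eqxx.
Qed.

(** * Roots of the cubic other than -2 and 2 *)

Lemma kappa_Dbullet x :
  D = Dbullet C -> (kappa C D).[x] = (x + 2) * (x - (4 - C) / 2) ^+ 2.
Proof.
by move=> ->; rewrite horner_kappa /Dbullet; field; rewrite two_neq0 four_neq0.
Qed.

(** Besides -2 the only candidate is the double root r = (4 - C) / 2, which is lost exactly when r =
    2, that is C = 0, or r = -2, that is C = 8. The additive form avoids truncated subtraction. *)
Lemma card_roots_Dbullet : D = Dbullet C ->
  (#|[set x | [&& root (kappa C D) x, x != -2%R & x != 2%R]]|
    + (C == 0%R) + (C == 8%R) = 1)%N.
Proof.
move=> D_eq; pose r : F := (4 - C) / 2.
have r_diag : (r == 2) = (C == 0).
  rewrite -subr_eq0 (_ : r - 2 = - C / 2); last by rewrite /r; field.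
  by rewrite mulf_eq0 oppr_eq0 invr_eq0 (negbTE two_neq0) orbF.
have r_opp : (r == -2) = (C == 8).
  rewrite -(subr_eq0 r) -(subr_eq0 C) -[RHS]oppr_eq0.
  rewrite (_ : r - -2 = - (C - 8) / 2); last by rewrite /r; field.
  by rewrite mulf_eq0 invr_eq0 (negbTE two_neq0) orbF.
have -> : [set x | [&& root (kappa C D) x, x != -2 & x != 2]]
            = if (C == 0) || (C == 8) then set0 else [set r].
  apply/setP => x; rewrite inE /root kappa_Dbullet // mulf_eq0 sqrf_eq0.
  rewrite addr_eq0 subr_eq0.
  have [->|x_neq] := eqVneq x r.
    rewrite orbT r_opp r_diag.
    by case: eqP => _; case: eqP => _; rewrite ?inE ?eqxx.
  rewrite orbF andbA andbN /=.
  by case: ifP; rewrite ?inE // (negbTE x_neq).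
have [C0|C_neq0] := eqVneq C 0; last by case: eqP; rewrite ?cards0 ?cards1.
(* The two brackets cannot both be 1, since 8 = 2 * 4 is nonzero. *)
have neq08 : (0 == 8 :> F) = false.
  by apply/negbTE; rewrite eq_sym (_ : 8 = 2 * 4) ?mulf_neq0 // -natrM.
by rewrite C0 neq08 cards0.
Qed.

(** Now -2 is not a root, and 2 is one exactly when C = 0, so excluding both values costs at most
    the root 2. *)
Lemma card_roots_neq : D <> Dbullet C ->
  (#|[set x | [&& root (kappa C D) x, x != -2%R & x != 2%R]]| + (C == 0%R)
    = N0 (kappa C D))%N.
Proof.
move=> /eqP D_neq.
have root_opp : root (kappa C D) (-2) = false.
  by rewrite /root kappa_opp2 mulf_eq0 (negbTE four_neq0) subr_eq0 (negbTE D_neq).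
have root_diag : root (kappa C D) 2 = (C == 0) by rewrite /root kappa_2 sqrf_eq0.
rewrite /N0 [RHS](cardsD1 2) inE root_diag addnC; congr (_ + _)%N.
apply: eq_card => x; rewrite !inE [RHS]andbC.
by have [->|_] := eqVneq x (-2); rewrite ?root_opp.
Qed.

End Count.

Theorem theorem8p1 (p : nat) (p_pr : prime p) (p_ge5 : (5 <= p)%N)
    (C D : 'F_p) :
  (D = Dbullet C ->
     (N2 (fCD C D))%:Z
       = (1 + (C == 0)%:Z) * p%:Z + 1 - (C == 0)%:Z - (C == 8)%:Z)
  /\
  (D <> Dbullet C ->
     (N2 (fCD C D))%:Z = (N0 (kappa C D))%:Z - (C == 0)%:Z).
Proof.
have two_neq0 : 2 != 0 :> 'F_p.
  by rewrite -(dvdn_pcharf (pchar_Fp p_pr)) gtnNdvd // (leq_trans _ p_ge5).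
rewrite N2_count // card_Fp //; split=> [D_eq|D_neq].
  (* Each of the one or two lines contributes p points; the number of remaining roots is 1 minus the
     two brackets. *)
  move: (@card_roots_Dbullet _ _ _ two_neq0 D_eq); rewrite D_eq eqxx andbT mul1n.
  by set k := #|_|; case: (C == 0); case: (C == 8) => /= k_eq; lia.
rewrite -card_roots_neq //; move/eqP/negbTE: D_neq => ->.
by rewrite andbF !mul0n !add0n PoszD addrK.
Qed.
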